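(* Consider a three-impulse coplanar maneuver between circular orbits: orbits $1,2,3,4$ are coplanar elliptic orbits with a common focus, with elements $(a_i,e_i,\omega_i)$, $a_i>0$, $0\le e_i<1$, where $e_1=e_4=0$, and the impulses are applied at polar angles $\theta_{12},\theta_{23},\theta_{34}$, where $\theta_{i(i+1)}$ is the junction of orbits $i$ and $i+1$. Assume the trajectory is smooth at all three junctions and all three impulses are nonzero. If the locations of two of the three impulses lie on a straight line passing through the focus, then the maneuver is a bi-elliptic Hohmann maneuver.
   Context: Orbits are described in polar coordinates $(r,\theta)$ about the common focus. An elliptic orbit with semi-major axis $a>0$, eccentricity $0\le e<1$ (circular iff $e=0$) and angle $\omega$ is the curve $r(\theta)=\dfrac{a(1-e^2)}{1+e\cos(\theta+\omega)}$; the true anomaly is $\theta+\omega$, so for $e>0$ the perigee is at $\theta+\omega\equiv 0$ and the apogee at $\theta+\omega\equiv\pi\pmod{2\pi}$; these two points are the apses. For a circular orbit $\omega$ is irrelevant and may be set to $0$. Smoothness at the junction of orbits $i$ and $i+1$ at polar angle $\theta_{i(i+1)}$ means that the two curves have, at $\theta=\theta_{i(i+1)}$, the same radius $r_i$ and the same slope $dr/d\theta$. The $i$th impulse (at the junction of orbits $i$ and $i+1$) is $\Delta v_i=\sqrt{\mu(2/r_i-1/a_{i+1})}-\sqrt{\mu(2/r_i-1/a_i)}$, where $\mu>0$ is the gravitational parameter; it is nonzero iff $a_i\ne a_{i+1}$. The locations of two impulses at polar angles $\theta,\theta'$ lie on a straight line through the focus iff $\theta-\theta'\in\pi\mathbb{Z}$.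 A bi-elliptic Hohmann maneuver here means: the two transfer orbits $2$ and $3$ are non-circular ellipses with a common apse line, and every impulse is applied at an apsis (true anomaly $0$ or $\pi$) of each transfer orbit it meets, i.e. $\theta_{12}+\omega_2$, $\theta_{23}+\omega_2$, $\theta_{23}+\omega_3$ and $\theta_{34}+\omega_3$ are all integer multiples of $\pi$. *)

(* Defs.v *)
From Stdlib Require Import Reals Lra.
From Coquelicot Require Import Coquelicot.

Open Scope R_scope.

Record orbit : Type := mk_orbit {
  semi_major : R;
  eccentricity : R;
  omega : R
}.

Definition elliptic (o : orbit) : Prop :=
  0 < semi_major o /\ 0 <= eccentricity o < 1.

Definition circular (o : orbit) : Prop := eccentricity o = 0.

Definition true_anomaly (o : orbit) (theta : R) : R := theta + omega o.

Definition radius (o : orbit) (theta : R) : R :=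
  semi_major o * (1 - eccentricity o ^ 2)
  / (1 + eccentricity o * cos (true_anomaly o theta)).

Definition position (o : orbit) (theta : R) : R * R :=
  (radius o theta * cos theta, radius o theta * sin theta).

Definition smooth_junction (o o' : orbit) (theta : R) : Prop :=
  radius o theta = radius o' theta /\
  Derive (radius o) theta = Derive (radius o') theta.

(* Difference of the two vis-viva speeds; meant for a junction where
   [radius o theta = radius o' theta], so either radius may be used. *)
Definition impulse (mu : R) (o o' : orbit) (theta : R) : R :=
  sqrt (mu * (2 / radius o theta - 1 / semi_major o'))
  - sqrt (mu * (2 / radius o theta - 1 / semi_major o)).

(* The focus is the origin. *)
Definition aligned_with_focus (P Q : R * R) : Prop :=
  exists u v : R, (u <> 0 \/ v <> 0) /\
    u * fst P + v * snd P = 0 /\ u * fst Q + v * snd Q = 0.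

Definition multiple_of_PI (x : R) : Prop := exists k : Z, x = IZR k * PI.

Definition at_apsis (o : orbit) (theta : R) : Prop :=
  multiple_of_PI (true_anomaly o theta).

Definition perigee (o : orbit) : R * R := position o (- omega o).

(* The apse line of a non-circular orbit is the line joining the focus to
   the perigee. *)
Definition common_apse_line (o o' : orbit) : Prop :=
  aligned_with_focus (perigee o) (perigee o').

Definition bi_elliptic_Hohmann
    (o2 o3 : orbit) (theta12 theta23 theta34 : R) : Prop :=
  (elliptic o2 /\ ~ circular o2) /\ (elliptic o3 /\ ~ circular o3) /\
  common_apse_line o2 o3 /\
  at_apsis o2 theta12 /\ at_apsis o2 theta23 /\
  at_apsis o3 theta23 /\ at_apsis o3 theta34.

Lemma radius_gt0 (o : orbit) (theta : R) : elliptic o -> 0 < radius o theta.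
Proof.
intros [Ha He]; unfold radius.
pose proof (COS_bound (true_anomaly o theta)).
apply Rdiv_lt_0_compat; [apply Rmult_lt_0_compat|]; nra.
Qed.

Lemma aligned_positions_iff (o o' : orbit) (theta theta' : R) :
  elliptic o -> elliptic o' ->
  aligned_with_focus (position o theta) (position o' theta')
  <-> multiple_of_PI (theta - theta').
Proof.
intros Ho Ho'.
pose proof (radius_gt0 o theta Ho) as Hr.
pose proof (radius_gt0 o' theta' Ho') as Hr'.
unfold aligned_with_focus, position; cbn [fst snd].
split.
- intros [u [v [Huv [H H']]]].
  assert (E : u * cos theta + v * sin theta = 0) by
    (apply (Rmult_eq_reg_l (radius o theta)); lra).
  assert (E' : u * cos theta' + v * sin theta' = 0) by
    (apply (Rmult_eq_reg_l (radius o' theta')); lra).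
  apply sin_eq_0_0; rewrite sin_minus.
  destruct Huv as [Hu|Hv].
  + apply (Rmult_eq_reg_l u); [|exact Hu].
    transitivity (sin theta * (u * cos theta' + v * sin theta')
                  - sin theta' * (u * cos theta + v * sin theta)); [ring|].
    rewrite E, E'; ring.
  + apply (Rmult_eq_reg_l v); [|exact Hv].
    transitivity (cos theta' * (u * cos theta + v * sin theta)
                  - cos theta * (u * cos theta' + v * sin theta')); [ring|].
    rewrite E, E'; ring.
- intros Hk; apply sin_eq_0_1 in Hk; rewrite sin_minus in Hk.
  exists (- sin theta), (cos theta); split; [|split].
  + pose proof (sin2_cos2 theta) as H1; unfold Rsqr in H1.
    destruct (Req_dec (cos theta) 0) as [H0|H0]; [left|now right].
    intros H2; rewrite H0 in H1; nra.
  + ring.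
  + transitivity (- radius o' theta' *
      (sin theta * cos theta' - cos theta * sin theta')); [ring|].
    rewrite Hk; ring.
Qed.

(* Main.v *)
(* Along an orbit, 1/r = (1 + e cos nu) / p with p = a (1 - e^2), and smoothness
   at a junction means that 1/r and its derivative - (e/p) sin nu agree there.
   A junction with a circular orbit therefore forces either the same semi-major
   axis or an apsis of a non-circular orbit, and a junction at an apsis of one
   transfer orbit is at an apsis of the other.  If the first and last impulses
   are aligned, the transfer orbits have the same apse line; off that line, equal
   derivatives give equal signed eccentricities e/p, then equal p, and hence
   equal semi-major axes, so the middle impulse would vanish. *)
Require Import Defs.
From Stdlib Require Import Reals Lra.
From Coquelicot Require Import Coquelicot.

Open Scope R_scope.

Definition semi_latus_rectum (o : orbit) : R :=
  semi_major o * (1 - eccentricity o ^ 2).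

Lemma semi_latus_rectum_gt0 (o : orbit) :
  elliptic o -> 0 < semi_latus_rectum o.
Proof.
intros [Ha He]; unfold semi_latus_rectum.
apply Rmult_lt_0_compat; nra.
Qed.

Lemma radius_denominator_gt0 (o : orbit) (theta : R) :
  elliptic o -> 0 < 1 + eccentricity o * cos (true_anomaly o theta).
Proof.
intros [Ha He]; pose proof (COS_bound (true_anomaly o theta)); nra.
Qed.

Lemma inv_radius (o : orbit) (theta : R) : elliptic o ->
  / radius o theta
  = (1 + eccentricity o * cos (true_anomaly o theta)) / semi_latus_rectum o.
Proof.
intros Ho.
pose proof (semi_latus_rectum_gt0 o Ho) as Hp.
pose proof (radius_denominator_gt0 o theta Ho) as Hd.
unfold radius; fold (semi_latus_rectum o); field; lra.
Qed.

(** Since $(1/r)' = -r'/r^2$, the slope is $r^2$ times $(e/p)\sin\nu$. The factor $r^2$ is kept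
    apart because it is common to both orbits at a junction and cancels there. *)
Lemma Derive_radius (o : orbit) (theta : R) : elliptic o ->
  Derive (radius o) theta
  = radius o theta ^ 2
    * (eccentricity o / semi_latus_rectum o * sin (true_anomaly o theta)).
Proof.
intros Ho.
pose proof (semi_latus_rectum_gt0 o Ho) as Hp.
pose proof (radius_denominator_gt0 o theta Ho) as Hd.
apply is_derive_unique; unfold radius; fold (semi_latus_rectum o).
unfold true_anomaly in *.
auto_derive; [lra | field; lra].
Qed.

Lemma smooth_junction_sym (o o' : orbit) (theta : R) :
  smooth_junction o o' theta -> smooth_junction o' o theta.
Proof. now intros [H H']. Qed.

Lemma smooth_junction_inv_radius (o o' : orbit) (theta : R) :
  elliptic o -> elliptic o' -> smooth_junction o o' theta ->
  (1 + eccentricity o * cos (true_anomaly o theta)) / semi_latus_rectum o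
  = (1 + eccentricity o' * cos (true_anomaly o' theta)) / semi_latus_rectum o'.
Proof.
intros Ho Ho' [Hr _].
now rewrite <- !inv_radius, Hr.
Qed.

Lemma smooth_junction_slope (o o' : orbit) (theta : R) :
  elliptic o -> elliptic o' -> smooth_junction o o' theta ->
  eccentricity o / semi_latus_rectum o * sin (true_anomaly o theta)
  = eccentricity o' / semi_latus_rectum o' * sin (true_anomaly o' theta).
Proof.
intros Ho Ho' [Hr Hd].
rewrite !Derive_radius, <- Hr in Hd by assumption.
apply Rmult_eq_reg_l in Hd; [exact Hd|].
apply pow_nonzero, Rgt_not_eq, radius_gt0, Ho.
Qed.

Lemma multiple_of_PI_sin (x : R) : multiple_of_PI x <-> sin x = 0.
Proof. split; [apply sin_eq_0_1 | apply sin_eq_0_0]. Qed.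

Lemma multiple_of_PI_minus (x y : R) :
  multiple_of_PI x -> multiple_of_PI y -> multiple_of_PI (x - y).
Proof.
intros [k ->] [l ->]; exists (k - l)%Z; rewrite minus_IZR; ring.
Qed.

Lemma multiple_of_PI_opp (x : R) : multiple_of_PI x -> multiple_of_PI (- x).
Proof. intros [k ->]; exists (- k)%Z; rewrite opp_IZR; ring. Qed.

(** The apse line passes through the focus, so turning by a multiple of $\pi$ stays on it. *)
Lemma at_apsis_shift (o : orbit) (theta theta' : R) :
  multiple_of_PI (theta - theta') -> at_apsis o theta -> at_apsis o theta'.
Proof.
unfold at_apsis, true_anomaly; intros Hd Ht.
replace (theta' + omega o) with (theta + omega o - (theta - theta')) by ring.
now apply multiple_of_PI_minus.
Qed.

Lemma impulse_neq0_semi_major (mu : R) (o o' : orbit) (theta : R) :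
  impulse mu o o' theta <> 0 -> semi_major o <> semi_major o'.
Proof. intros H E; apply H; unfold impulse; rewrite E; ring. Qed.

(** At an apsis the slope vanishes; the slope of [o'] then vanishes too, and since $e'/p' \neq 0$
    this forces $\sin\nu' = 0$. *)
Lemma smooth_junction_at_apsis (o o' : orbit) (theta : R) :
  elliptic o -> elliptic o' -> ~ circular o' -> smooth_junction o o' theta ->
  at_apsis o theta -> at_apsis o' theta.
Proof.
intros Ho Ho' Hc Hs Ha.
apply multiple_of_PI_sin in Ha; apply multiple_of_PI_sin.
pose proof (smooth_junction_slope o o' theta Ho Ho' Hs) as E.
pose proof (semi_latus_rectum_gt0 o' Ho') as Hp.
rewrite Ha, Rmult_0_r in E; symmetry in E.
apply Rmult_integral in E as [E|E]; [|exact E].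
exfalso; apply Hc; unfold circular.
apply (Rmult_eq_reg_r (/ semi_latus_rectum o')).
- now rewrite Rmult_0_l.
- now apply Rinv_neq_0_compat, Rgt_not_eq.
Qed.

(** Uses $a = p/(1-e^2)$. Squares suffice, and coaxial orbits will yield their eccentricities only
    up to sign. *)
Lemma semi_major_eq (o o' : orbit) : elliptic o ->
  semi_latus_rectum o = semi_latus_rectum o' ->
  eccentricity o ^ 2 = eccentricity o' ^ 2 ->
  semi_major o = semi_major o'.
Proof.
unfold semi_latus_rectum; intros [_ He] Hp H2; rewrite <- H2 in Hp.
apply Rmult_eq_reg_r in Hp; [exact Hp | nra].
Qed.

(** Two circles that meet have the same radius, hence the same semi-major axis, so [o'] is not a
    circle; the zero slope of the circle then puts the junction at an apsis of [o']. *)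
Lemma circular_junction (o o' : orbit) (theta : R) :
  elliptic o -> elliptic o' -> circular o -> smooth_junction o o' theta ->
  semi_major o <> semi_major o' -> ~ circular o' /\ at_apsis o' theta.
Proof.
intros Ho Ho' Hc Hs Ha.
assert (Hc' : ~ circular o').
{ intros Hc'; apply Ha.
  pose proof (smooth_junction_inv_radius o o' theta Ho Ho' Hs) as E.
  unfold circular in Hc, Hc'.
  apply semi_major_eq; [exact Ho| |now rewrite Hc, Hc'].
  rewrite Hc, Hc', !Rmult_0_l, !Rplus_0_r in E; unfold Rdiv in E.
  rewrite !Rmult_1_l in E; now apply Rinv_eq_reg. }
split; [exact Hc'|].
apply multiple_of_PI_sin.
pose proof (smooth_junction_slope o o' theta Ho Ho' Hs) as E.
pose proof (semi_latus_rectum_gt0 o' Ho') as Hp.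
unfold circular in Hc, Hc'.
rewrite Hc in E; unfold Rdiv in E; rewrite !Rmult_0_l in E; symmetry in E.
apply Rmult_integral in E as [E|E]; [|exact E].
apply Rmult_integral in E as [E|E]; [contradiction|].
now apply Rinv_neq_0_compat in E; [|apply Rgt_not_eq].
Qed.

Lemma coaxial_junction_at_apsis (o o' : orbit) (theta : R) :
  elliptic o -> elliptic o' -> smooth_junction o o' theta ->
  semi_major o <> semi_major o' -> multiple_of_PI (omega o - omega o') ->
  at_apsis o theta.
Proof.
intros Ho Ho' Hs Ha Hw.
apply multiple_of_PI_sin in Hw.
apply multiple_of_PI_sin.
destruct (Req_dec (sin (true_anomaly o theta)) 0) as [H0|H0]; [exact H0|].
exfalso; apply Ha.
pose proof (smooth_junction_inv_radius o o' theta Ho Ho' Hs) as E.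
pose proof (smooth_junction_slope o o' theta Ho Ho' Hs) as E'.
pose proof (semi_latus_rectum_gt0 o Ho) as Hp.
pose proof (semi_latus_rectum_gt0 o' Ho') as Hp'.
(* [eps] is 1 or -1: the perigees lie on the same or on opposite sides. *)
set (eps := cos (omega o - omega o')).
assert (Heps : eps * eps = 1).
{ pose proof (sin2_cos2 (omega o - omega o')) as H; unfold Rsqr in H.
  rewrite Hw in H; unfold eps; lra. }
assert (Hnu : true_anomaly o' theta
              = true_anomaly o theta - (omega o - omega o'))
  by (unfold true_anomaly; ring).
rewrite Hnu, cos_minus, Hw in E; rewrite Hnu, sin_minus, Hw in E'.
fold eps in E, E'.
set (c := cos (true_anomaly o theta)) in *.
set (s := sin (true_anomaly o theta)) in *.
assert (Eq : eccentricity o / semi_latus_rectum o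
             = eps * (eccentricity o' / semi_latus_rectum o')).
{ apply (Rmult_eq_reg_r s); [|exact H0]; rewrite E'; ring. }
assert (Ep : semi_latus_rectum o = semi_latus_rectum o').
(* Removing the term $(e/p)\cos\nu$ from $1/r$ leaves $1/p$, and by [Eq] that term is the same for
   both orbits. *)
{ apply Rinv_eq_reg.
  transitivity ((1 + eccentricity o * c) / semi_latus_rectum o
                - eccentricity o / semi_latus_rectum o * c); [field; lra|].
  rewrite E, Eq; field; lra. }
apply semi_major_eq; [exact Ho|exact Ep|].
rewrite Ep in Eq.
assert (Ee : eccentricity o = eps * eccentricity o').
{ apply (Rmult_eq_reg_r (/ semi_latus_rectum o'));
    [unfold Rdiv in Eq; lra | now apply Rinv_neq_0_compat, Rgt_not_eq]. }
rewrite Ee; transitivity (eps * eps * eccentricity o' ^ 2); [ring|].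
rewrite Heps; ring.
Qed.

Theorem proposition3p3
  (mu : R) (o1 o2 o3 o4 : orbit) (theta12 theta23 theta34 : R)
  (hmu : 0 < mu)
  (ho1 : elliptic o1) (ho2 : elliptic o2)
  (ho3 : elliptic o3) (ho4 : elliptic o4)
  (hc1 : circular o1) (hc4 : circular o4)
  (hs12 : smooth_junction o1 o2 theta12)
  (hs23 : smooth_junction o2 o3 theta23)
  (hs34 : smooth_junction o3 o4 theta34)
  (hv12 : impulse mu o1 o2 theta12 <> 0)
  (hv23 : impulse mu o2 o3 theta23 <> 0)
  (hv34 : impulse mu o3 o4 theta34 <> 0)
  (halign :
     aligned_with_focus (position o1 theta12) (position o2 theta23) \/
     aligned_with_focus (position o2 theta23) (position o3 theta34) \/
     aligned_with_focus (position o1 theta12) (position o3 theta34)) :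
  bi_elliptic_Hohmann o2 o3 theta12 theta23 theta34.
Proof.
apply impulse_neq0_semi_major in hv12, hv23, hv34.
rewrite !aligned_positions_iff in halign by assumption.
destruct (circular_junction o1 o2 theta12) as [Hn2 H12]; try assumption.
(* The last junction is read backwards, from the final circle to orbit 3. *)
destruct (circular_junction o4 o3 theta34) as [Hn3 H34];
  [assumption..|now apply smooth_junction_sym|now apply not_eq_sym|].
assert (H23 : at_apsis o2 theta23 /\ at_apsis o3 theta23).
{ destruct halign as [H|[H|H]].
  - assert (at_apsis o2 theta23) by now apply (at_apsis_shift o2 theta12).
    split; [assumption|now apply (smooth_junction_at_apsis o2)].
  - assert (at_apsis o3 theta23).
    { apply (at_apsis_shift o3 theta34); [|assumption].
      rewrite <- Ropp_minus_distr; now apply multiple_of_PI_opp. }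
    split; [|assumption].
    apply (smooth_junction_at_apsis o3); try assumption.
    now apply smooth_junction_sym.
  - assert (at_apsis o2 theta23).
    { apply (coaxial_junction_at_apsis o2 o3); try assumption.
      (* The direction [theta34] lies on the apse lines of both transfer orbits, so these lines
         coincide. *)
      pose proof (at_apsis_shift o2 _ _ H H12) as H24.
      replace (omega o2 - omega o3)
        with (true_anomaly o2 theta34 - true_anomaly o3 theta34)
        by (unfold true_anomaly; ring).
      now apply multiple_of_PI_minus. }
    split; [assumption|now apply (smooth_junction_at_apsis o2)]. }
destruct H23 as [H2 H3].
repeat split; try assumption; try apply ho2; try apply ho3.
(* The perigees have polar angles $-\omega_2$ and $-\omega_3$; their difference is that of the true
   anomalies at the shared apsis [theta23]. *)
apply aligned_positions_iff; [assumption..|].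
replace (- omega o2 - - omega o3)
  with (true_anomaly o3 theta23 - true_anomaly o2 theta23)
  by (unfold true_anomaly; ring).
now apply multiple_of_PI_minus.
Qed.
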